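(* Let $G=([n],E)$ be a connected regular graph with eigenspaces ordered as $\Lambda_1<\cdots<\Lambda_m$, where $\Lambda_1=\operatorname{span}\{\mathbb{1}\}$. Let $W\subseteq[n]$ and let $1\le k<m$. Let $u_1^*,\dots,u_n^*$ be the columns of the matrix $U_{\overline{\mathbf k}}$ whose rows are the rows of $U$ that span $\Lambda_1,\Lambda_{k+1},\dots,\Lambda_m$, and let $P_{\overline{\mathbf k}}=\operatorname{conv}\{u_1^*,\dots,u_n^*\}$. Then $W$ is a positively weighted $k$-design of $G$ if and only if there is a face $F\neq P_{\overline{\mathbf k}}$ of $P_{\overline{\mathbf k}}$ (the empty face is allowed) such that $[n]\setminus W=\{i\in[n]: u_i^*\in F\}$. Moreover, $W$ is a minimal positively weighted $k$-design of $G$ if and only if there is a facet $F$ of $P_{\overline{\mathbf k}}$ such that $[n]\setminus W=\{i\in[n]: u_i^*\in F\}$.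
   Context: $G=([n],E)$ is a finite, simple, undirected, connected, $\delta$-regular graph with adjacency matrix $A$ and degree matrix $D=\delta I$. The eigenvalues and eigenspaces of $G$ are those of $AD^{-1}=\frac1\delta A$; it has $m$ distinct eigenspaces. Vectors $\phi\in\mathbb{R}^n$ are viewed as functions on the vertices. The eigenspace of eigenvalue $1$ is $\Lambda_1=\operatorname{span}\{\mathbb{1}\}$, with $\mathbb{1}$ the all-ones vector, and it is always ordered first. $U\in\mathbb{R}^{n\times n}$ is a matrix whose rows are $n$ pairwise orthogonal eigenvectors of $AD^{-1}$, grouped by eigenspace in the chosen order, with first row $\mathbb{1}$. A subset $W\subseteq[n]$ is a positively weighted $k$-design if there are weights $a_w>0$ ($w\in W$) such that $\sum_{w\in W}a_w\phi(w)=\frac1n\sum_{v\in[n]}\phi(v)$ for every $\phi\in\Lambda_1\cup\cdots\cup\Lambda_k$. It is minimal if no proper subset of $W$ is a positively weighted $k$-design. A facet of a polytope is a face of codimension one. The faces of a polytope include the empty set and the polytope itself. *)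

(* Defs.v *)
From HB Require Import structures.
From mathcomp Require Import all_boot all_order all_algebra.
From mathcomp Require Import boolp classical_sets reals.

Set Implicit Arguments.
Unset Strict Implicit.
Unset Printing Implicit Defensive.
Import Order.TTheory GRing.Theory Num.Theory.
Local Open Scope ring_scope.

(* Vertices are 'I_n (numbered from 0); a graph is its edge relation. *)
Section Graphs.
Variables (R : realType) (n : nat).
Implicit Types (e : rel 'I_n) (U : 'M[R]_n) (W : {set 'I_n}).

Definition simple_graph e : Prop := symmetric e /\ irreflexive e.

Definition connected_graph e : Prop := forall x y, connect e x y.

Definition regular_graph e (delta : nat) : Prop :=
  forall x, #|[set y | e x y]%SET| = delta.

Definition adjacency_mx e : 'M[R]_n := \matrix_(i, j) (e i j)%:R.

Definition degree_mx e : 'M[R]_n :=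
  diag_mx (\row_i #|[set y | e i y]%SET|%:R).

Definition walk_mx e : 'M[R]_n := adjacency_mx e *m invmx (degree_mx e).

(* The library's eigenspace consists of row vectors acted on from the right, so
   the (column) eigenvectors of A D^-1 are obtained through the transpose. *)
Definition graph_eigenspace e (a : R) : 'M[R]_n := eigenspace (walk_mx e)^T a.

Definition graph_eigenvalue e (a : R) : bool := eigenvalue (walk_mx e)^T a.

(* An ordering of the eigenspaces is given by the corresponding ordering of the
   m distinct eigenvalues. *)
Definition eigen_ordering e (m : nat) (lam : m.-tuple R) : Prop :=
  uniq lam /\ forall a, (a \in lam) = graph_eigenvalue e a.

(* Lambda_j, numbered from 1: only meaningful for 1 <= j <= m. *)
Definition Lambda e (m : nat) (lam : m.-tuple R) (j : nat) : 'M[R]_n :=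
  graph_eigenspace e lam`_j.-1.

Definition eigenvector_matrix e (m : nat) (lam : m.-tuple R) U : Prop :=
  [/\ forall i, row i U != 0 /\
        exists2 j : nat, (1 <= j <= m)%N & (row i U <= Lambda e lam j)%MS,
      forall i i', i != i' -> row i U *m (row i' U)^T = 0,
      forall (i i' : 'I_n) (j j' : nat), (i <= i')%N ->
        (1 <= j <= m)%N -> (1 <= j' <= m)%N ->
        (row i U <= Lambda e lam j)%MS -> (row i' U <= Lambda e lam j')%MS ->
        (j <= j')%N
    & forall i : 'I_n, i = 0%N :> nat -> row i U = const_mx 1].

Definition positive_design e (m : nat) (lam : m.-tuple R) (k : nat) W : Prop :=
  exists a : 'I_n -> R,
    (forall w, w \in W -> 0 < a w) /\
    forall (j : nat) (phi : 'rV[R]_n), (1 <= j <= k)%N ->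
      (phi <= Lambda e lam j)%MS ->
      \sum_(w in W) a w * phi 0 w = n%:R^-1 * \sum_v phi 0 v.

Definition minimal_positive_design e (m : nat) (lam : m.-tuple R) (k : nat) W
    : Prop :=
  positive_design e lam k W /\
  forall W', W' \proper W -> ~ positive_design e lam k W'.

Definition kbar_rows e (m : nat) (lam : m.-tuple R) U (k : nat) : {set 'I_n} :=
  [set i | (row i U <= Lambda e lam 1)%MS ||
           has (fun j => (row i U <= Lambda e lam j)%MS) (iota k.+1 (m - k))]%SET.

(* enum_val is increasing on ordinals, so the rows keep their order. *)
Definition Ukbar e (m : nat) (lam : m.-tuple R) U (k : nat) :
    'M[R]_(#|kbar_rows e lam U k|, n) :=
  rowsub (@enum_val _ (mem (kbar_rows e lam U k))) U.

End Graphs.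

Section Polytopes.
Variables (R : realType) (r : nat).
Implicit Types S P F : set 'cV[R]_r.

Definition conv (n : nat) (u : 'I_n -> 'cV[R]_r) : set 'cV[R]_r :=
  [set x | exists a : 'I_n -> R,
    [/\ forall i, 0 <= a i, \sum_i a i = 1 & x = \sum_i a i *: u i]]%classic.

(* The functional c may be 0, so that set0 and P are faces of P. *)
Definition is_face P F : Prop :=
  exists (c : 'rV[R]_r) (d : R),
    (forall x, P x -> (c *m x) 0 0 <= d) /\
    F = [set x | P x /\ (c *m x) 0 0 = d]%classic.

Definition affine_hull S : set 'cV[R]_r :=
  [set x | exists (p : nat) (v : 'I_p -> 'cV[R]_r) (a : 'I_p -> R),
    [/\ forall i, S (v i), \sum_i a i = 1 & x = \sum_i a i *: v i]]%classic.

(* The affine dimension is d; the empty set has dimension -1. *)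
Definition has_dim S (d : int) : Prop :=
  (S = set0 /\ d = -1) \/
  exists (x0 : 'cV[R]_r) (V : {vspace 'cV[R]_r}),
    affine_hull S = [set x | x - x0 \in V]%classic /\ d = (\dim V)%:Z.

Definition is_facet P F : Prop :=
  is_face P F /\ exists d : int, has_dim P d /\ has_dim F (d - 1).

End Polytopes.

(* Main.v *)
Require Import Defs.
From HB Require Import structures.
From mathcomp Require Import all_boot all_order all_algebra.
From mathcomp Require Import boolp classical_sets reals.

Set Implicit Arguments.
Unset Strict Implicit.
Unset Printing Implicit Defensive.
Import Order.TTheory GRing.Theory Num.Theory.
Local Open Scope ring_scope.

(** A family of weights with support W turns W into a design exactly when it is
    a nonnegative vector of the row space of the matrix M formed by the rows of
    U that span Lambda_1, Lambda_{k+1}, ..., Lambda_m, up to scaling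
    ([positive_design_support]).  Indeed the design conditions for Lambda_2,
    ..., Lambda_k say that the weights are orthogonal to the corresponding rows
    of U; since the rows of U are pairwise orthogonal and form a basis, this
    means that the weights lie in the span of the other rows, which are those
    of M.  The condition for Lambda_1 fixes the sum of the weights, which is
    achieved by scaling as soon as the vector is not 0.

    On the other hand, a vector of the row space of M is c *m M for a linear
    functional c, and its i-th entry is the value of c at the i-th column of M.
    The all-ones vector is h *m M for some h, so that all the columns lie in
    the affine hyperplane of height 1 for h; there an affine inequality becomes
    homogeneous, and a face of the polytope P spanned by the columns is
    the zero set on P of a functional c which is nonnegative on the columns.
    The columns outside this face are those in the support of c *m M, and the
    face is proper iff c is not 0, because the rows of M are independent.  Thus
    both the designs and the complements of proper faces are the supports of
    the nonzero nonnegative vectors c *m M ([proper_face_support]).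

    As for facets, the affine dimension of a set of points of height 1 is one
    less than the dimension of its linear span ([has_dim_span]).  So the face
    of c is a facet iff the columns that it contains span a linear hyperplane,
    i.e. iff every functional vanishing on them is a multiple of c
    ([dim_hyperplaneP]).  If this holds, a design inside the support of c *m M
    comes from a multiple of c, hence has the same support.  If it fails, some
    functional c' vanishes on these columns and is not a multiple of c; moving
    from c in direction - c' until an entry of c *m M reaches 0 yields
    a strictly smaller support ([reduce_support]).  So facets correspond to
    minimal supports ([minimal_support_facet]). *)

(** * Linear functionals on column vectors *)

Section LinearFunctionals.
Variables (F : fieldType) (r : nat).
Implicit Types (c : 'rV[F]_r) (x y : 'cV[F]_r) (Y : {vspace 'cV[F]_r}).

Definition annihilated c : {vspace 'cV[F]_r} :=
  lker (linfun (mulmx c : 'cV[F]_r -> 'cV[F]_1)).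

Lemma mem_annihilated c x : (x \in annihilated c) = ((c *m x) 0 0 == 0).
Proof.
rewrite memv_ker lfunE /=; apply/eqP/eqP => [->|cx0]; first by rewrite mxE.
by apply/matrixP => i j; rewrite !ord1 cx0 mxE.
Qed.

(** A functional that does not vanish on Y maps it onto the line of scalars, so
    that its kernel on Y has codimension 1. *)
Lemma dim_cap_annihilated c Y x : x \in Y -> (c *m x) 0 0 != 0 ->
  \dim Y = (\dim (Y :&: annihilated c)).+1.
Proof.
move=> Yx cx0; rewrite -(limg_ker_dim (linfun (mulmx c : 'cV_r -> 'cV[F]_1)) Y).
rewrite -[RHS]addn1; congr addn; apply/eqP; rewrite eqn_leq; apply/andP; split.
  by rewrite (leq_trans (dimvS (subvf _)))// dimvf dim_matrix.
rewrite lt0n dimv_eq0 -lkerE; apply: contra cx0 => /subvP/(_ _ Yx).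
by rewrite mem_annihilated.
Qed.

Lemma exists_nonzero_value c : c != 0 -> exists x, (c *m x) 0 0 != 0.
Proof.
case/rV0Pn => j cj; exists (delta_mx j 0).
by rewrite -colE mxE.
Qed.

Lemma dim_annihilated c : c != 0 -> (\dim (annihilated c)).+1 = r.
Proof.
case/exists_nonzero_value => x cx.
have := dim_cap_annihilated (memvf x) cx.
by rewrite capfv dimvf dim_matrix mulr1.
Qed.

(** The projection onto a complement of Y kills Y but not x, so one of its
    coordinates is the required functional. *)
Lemma separating_functional Y x : x \notin Y ->
  exists c, (Y <= annihilated c)%VS /\ (c *m x) 0 0 != 0.
Proof.
move=> Yx; pose f : 'End('cV[F]_r) := (\1 - projv Y)%VF.
pose c j : 'rV[F]_r := \row_i f (delta_mx i 0) j 0.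
have cE j y : (c j *m y) 0 0 = f y j 0.
  rewrite [in RHS](matrix_sum_delta y) linear_sum summxE mxE.
  apply: eq_bigr => i _; rewrite big_ord1 linearZ mxE mulrC mxE.
  by congr (_ * _).
have fx : f x != 0.
  apply: contra Yx; rewrite /f !lfunE/= opp_lfunE id_lfunE subr_eq0.
  by move/eqP->; exact: memv_proj.
have [j fxj] : exists j, f x j 0 != 0 by case/cV0Pn: fx => j; exists j.
exists (c j); split; last by rewrite cE.
apply/subvP => y Yy; rewrite mem_annihilated cE /f !lfunE/= opp_lfunE id_lfunE.
by rewrite projv_id// subrr mxE.
Qed.

(** The factor is c' x / c x for any x with c x != 0: each vector y differs from
    a multiple of x by an element of the kernel of c. *)
Lemma annihilated_proportional c c' : c != 0 ->
  (annihilated c <= annihilated c')%VS -> exists t, c' = t *: c.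
Proof.
case/exists_nonzero_value => x cx sub.
set d := (c *m x) 0 0 in cx.
have ev b y t : (b *m (y - t *: x)) 0 0 = (b *m y) 0 0 - t * (b *m x) 0 0.
  by rewrite mulmxBr -scalemxAr; move: (b *m y) (b *m x) => ? ?; rewrite !mxE.
exists ((c' *m x) 0 0 / d); apply/rowP => j.
pose y : 'cV[F]_r := delta_mx j 0.
have : y - ((c *m y) 0 0 / d) *: x \in annihilated c.
  by rewrite mem_annihilated ev -/d mulfVK ?subrr.
move/(subvP sub); rewrite mem_annihilated ev subr_eq0 /y -!colE.
by rewrite !(mxE _ _ 0 0) mxE mulrC mulrA mulrAC => /eqP.
Qed.

(** This turns the dimension of a facet into a statement about functionals.  If
    Y is strictly smaller than the kernel of c, a functional separating Y from
    a point of this kernel cannot be a multiple of c. *)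
Lemma dim_hyperplaneP c Y : c != 0 -> (Y <= annihilated c)%VS ->
  ((\dim Y).+1 = r <->
   forall c', (Y <= annihilated c')%VS -> exists t, c' = t *: c).
Proof.
move=> c0 Yc; split => [dimY c' Yc'|prop].
  apply: annihilated_proportional => //; rewrite (_ : annihilated c = Y)//.
  apply/eqP; rewrite eq_sym eqEdim Yc -ltnS.
  by rewrite (dim_annihilated c0) dimY leqnn.
suff Yann : Y = annihilated c by rewrite Yann; exact: dim_annihilated.
apply/eqP; rewrite eqEsubv Yc; apply/subvP => x cx.
apply: contraT => /separating_functional [c' [/prop[t ->]]].
rewrite -scalemxAl mxE (eqP (_ : (c *m x) 0 0 == 0)) -?mem_annihilated//.
by rewrite mulr0 eqxx.
Qed.

End LinearFunctionals.

(** * Affine dimension of sets of points of height 1 *)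

Section Dimension.
Variables (R : realType) (r : nat) (h : 'rV[R]_r).
Implicit Types (S : set 'cV[R]_r) (X : seq 'cV[R]_r) (x : 'cV[R]_r).

(** On points of height 1 the sum of the coefficients of a linear combination is
    the height of its value, so that the affine combinations are the linear
    combinations of height 1. *)
Lemma affine_hullE S X :
  (forall x, S x -> (h *m x) 0 0 = 1) -> (forall x, S x -> x \in <<X>>%VS) ->
  (forall x, x \in X -> S x) ->
  forall x, affine_hull S x <-> x \in <<X>>%VS /\ (h *m x) 0 0 = 1.
Proof.
move=> Sh SX XS x; split=> [[p [v [a [Sv a1 ->]]]]|[xX hx]].
  split; first by apply: memv_suml => i _; exact/memvZ/SX/Sv.
  rewrite mulmx_sumr summxE -[RHS]a1; apply: eq_bigr => i _.
  by rewrite -scalemxAr mxE Sh ?mulr1.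
have Xi (i : 'I_(size X)) : S X`_i by apply/XS/mem_nth.
have xE := coord_span (X := in_tuple X) xX.
exists (size X), (fun i => X`_i), (fun i => coord (in_tuple X) i x).
split => //; rewrite -[RHS]hx [in RHS]xE mulmx_sumr summxE.
by apply: eq_bigr => i _; rewrite -scalemxAr mxE Sh ?mulr1.
Qed.

(** The affine hull is a translate of the vectors of height 0 in the span, a
    subspace of codimension 1 unless the set is empty; in that case the span is
    0 and the affine dimension is -1. *)
Lemma has_dim_span S X d :
  (forall x, S x -> (h *m x) 0 0 = 1) -> (forall x, S x -> x \in <<X>>%VS) ->
  (forall x, x \in X -> S x) ->
  has_dim S d <-> (\dim <<X>>)%:Z = d + 1.
Proof.
move=> Sh SX XS; have hullE := affine_hullE Sh SX XS.
case: X SX XS hullE => [|y X] SX XS hullE.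
  have S0 : S = set0.
    apply/seteqP; split => // x Sx; have := SX x Sx.
    by rewrite span_nil memv0 => /eqP x0; have := Sh x Sx;
       rewrite x0 mulmx0 mxE => /esym/eqP; rewrite oner_eq0.
  rewrite span_nil dimv0; split => [[[_ ->]//|[x0 [V [hull _]]]]|d1].
    have : affine_hull S x0 by rewrite hull /= subrr mem0v.
    case/hullE; rewrite span_nil memv0 => /eqP->.
    by rewrite mulmx0 mxE => /esym/eqP; rewrite oner_eq0.
  by left; split => //; apply/eqP; rewrite -addr_eq0 -d1.
set Z := <<y :: X>>%VS in SX hullE *.
have Sy : S y by apply: XS; rewrite mem_head.
have dimZ : \dim Z = (\dim (Z :&: annihilated h)).+1.
  by apply: (dim_cap_annihilated (SX _ Sy)); rewrite Sh ?oner_eq0.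
(* Every point of the hull, not just y, gives the same direction space: hence
   the dimension cannot depend on the base point chosen in [has_dim]. *)
have dirE x0 : affine_hull S x0 -> forall x,
    affine_hull S x <-> x - x0 \in (Z :&: annihilated h)%VS.
  case/hullE => Zx0 hx0 x; rewrite memv_cap mem_annihilated mulmxBr.
  have -> : (h *m x - h *m x0) 0 0 = (h *m x) 0 0 - 1.
    by rewrite -hx0; move: (h *m x) (h *m x0) => ? ?; rewrite !mxE.
  rewrite subr_eq0 (rpredBr _ Zx0); split => [/hullE[-> ->]|/andP[? /eqP?]].
    by rewrite eqxx.
  exact/hullE.
have hully : affine_hull S y by apply/hullE; split; [exact: SX|exact: Sh].
rewrite dimZ -addn1 PoszD; split => [[[S0]|[x0 [V [hull ->]]]]|/addIr <-].
- by move: Sy; rewrite S0.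
- have hx0 : affine_hull S x0 by rewrite hull /= subrr mem0v.
  congr (Posz (\dim _) + 1); apply/vspaceP => v; apply/idP/idP => vV.
    have: affine_hull S (v + x0).
      by apply/(dirE _ hx0); rewrite addrK.
    by rewrite hull /= addrK.
  have : affine_hull S (v + x0) by rewrite hull /= addrK.
  by move/(dirE _ hx0); rewrite addrK.
- right; exists y, (Z :&: annihilated h)%VS; split => //.
  by apply/seteqP; split => x /(dirE _ hully).
Qed.

End Dimension.

(** * Faces and facets as zero sets of functionals *)

Section Polytope.
Variables (R : realType) (r n : nat) (M : 'M[R]_(r, n)) (h : 'rV[R]_r).
Hypotheses (M_free : row_free M) (hM : h *m M = const_mx 1).
Implicit Types (W : {set 'I_n}) (a c : 'rV[R]_r).

Let u i := col i M.
Let P := conv u.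

(** The supports of the nonzero nonnegative vectors of the row space of M; they
    are parametrized by functionals c because M has independent rows. *)
Definition positive_support c W : Prop :=
  [/\ c != 0, forall i, 0 <= (c *m M) 0 i & W = [set i | (c *m M) 0 i != 0]%SET].

Lemma mul_col c i : (c *m u i) 0 0 = (c *m M) 0 i.
Proof. by rewrite !mxE; apply: eq_bigr => j _; rewrite !mxE. Qed.

Lemma conv_vertex i : P (u i).
Proof.
exists (fun j => (j == i)%:R); split.
- by move=> j; rewrite ler0n.
- by rewrite (bigD1 i)//= eqxx big1 ?addr0// => j /negPf->.
- by rewrite (bigD1 i)//= eqxx scale1r big1 ?addr0// => j /negPf->; rewrite scale0r.
Qed.

Lemma mul_conv c (b : 'I_n -> R) :
  (c *m \sum_i b i *: u i) 0 0 = \sum_i b i * (c *m M) 0 i.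
Proof.
rewrite mulmx_sumr summxE; apply: eq_bigr => i _.
by rewrite -scalemxAr mxE mul_col.
Qed.

Lemma conv_height x : P x -> (h *m x) 0 0 = 1.
Proof.
case=> b [_ b1 ->]; rewrite mul_conv -[RHS]b1; apply: eq_bigr => i _.
by rewrite hM mxE mulr1.
Qed.

Lemma functional_eq0 c : (forall i, (c *m M) 0 i = 0) -> c = 0.
Proof.
move=> cM; apply: (row_free_inj M_free); rewrite mul0mx.
by apply/rowP => i; rewrite cM mxE.
Qed.

Definition zero_face c : set 'cV[R]_r := [set x | P x /\ (c *m x) 0 0 = 0]%classic.

Lemma zero_face_is_face c : (forall i, 0 <= (c *m M) 0 i) -> is_face P (zero_face c).
Proof.
move=> c0; exists (- c), 0; split => [x [b [b0 _ ->]]|].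
  rewrite mulNmx mxE mul_conv oppr_le0 sumr_ge0// => i _.
  exact: mulr_ge0.
apply/seteqP; split => x /= [Px cx]; split => //.
  by rewrite mulNmx mxE cx oppr0.
by move: cx; rewrite mulNmx mxE => /eqP; rewrite oppr_eq0 => /eqP.
Qed.

(** Since h is 1 on P, the inequality c x <= d reads (d *: h - c) x >= 0, which
    is homogeneous. *)
Lemma is_face_zero_face F : is_face P F -> exists c,
  (forall i, 0 <= (c *m M) 0 i) /\ F = zero_face c.
Proof.
case=> c [d [cP ->]]; exists (d *: h - c).
have val x : P x -> ((d *: h - c) *m x) 0 0 = d - (c *m x) 0 0.
  move=> Px; rewrite mulmxBl -scalemxAl; have := conv_height Px.
  by move: (h *m x) (c *m x) => ? ? hx; rewrite !mxE hx mulr1.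
split => [i|]; first by rewrite -mul_col val ?subr_ge0;
  [apply: cP|]; exact: conv_vertex.
apply/seteqP; split => x /= [Px] cx; split => //; first by rewrite val// cx subrr.
by move: cx; rewrite val// => /subr0_eq.
Qed.

Lemma mem_zero_face c i : (u i \in zero_face c) = ((c *m M) 0 i == 0).
Proof.
apply/idP/eqP; first by rewrite in_setE => -[_]; rewrite mul_col.
by move=> ci; rewrite in_setE; split; [exact: conv_vertex|rewrite mul_col].
Qed.

(** A face that contains all the columns comes from a functional vanishing on
    them all, and these columns span the whole space. *)
Lemma zero_face_proper c : c != 0 <-> zero_face c <> P.
Proof.
split => [c0 FP|]; last first.
  apply: contra_notN => /eqP ->; apply/seteqP; split => x; first by case.
  by split => //; rewrite mul0mx mxE.
move/eqP: c0; apply; apply: functional_eq0 => i; apply/eqP.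
by rewrite -mem_zero_face FP in_setE; exact: conv_vertex.
Qed.

Lemma setC_zero_face W c :
  ~: W = [set i | u i \in zero_face c]%SET <-> W = [set i | (c *m M) 0 i != 0]%SET.
Proof.
split => [/(congr1 (@finset.setC _))|->]; [rewrite finset.setCK => ->|];
  by apply/setP => i; rewrite !inE mem_zero_face ?negbK.
Qed.

Lemma proper_face_support W :
  (exists F, [/\ is_face P F, F <> P & ~: W = [set i | u i \in F]%SET]) <->
  (exists c, positive_support c W).
Proof.
split => [[_ [/is_face_zero_face[c [c0 ->]] /zero_face_proper cn0 /setC_zero_face WE]]|].
  by exists c.
case=> c [cn0 c0 WE]; exists (zero_face c).
split; [exact: zero_face_is_face|exact/zero_face_proper|exact/setC_zero_face].
Qed.

Definition vertices (I : {set 'I_n}) : seq 'cV[R]_r := [seq u i | i <- enum I].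

Lemma sub_annihilated I c :
  (<<vertices I>> <= annihilated c)%VS <-> forall i, i \in I -> (c *m M) 0 i = 0.
Proof.
split => [/subvP sub i Ii|c0].
  apply/eqP; rewrite -mul_col -mem_annihilated; apply: sub.
  by apply/memv_span/map_f; rewrite mem_enum.
apply/span_subvP => x /mapP[i]; rewrite mem_enum => Ii ->.
by rewrite mem_annihilated mul_col c0.
Qed.

(** A vector outside the span of the columns would be separated from it by a
    nonzero functional c with c *m M = 0. *)
Lemma dim_vertices : \dim <<vertices [set: 'I_n]%SET>> = r.
Proof.
suff -> : <<vertices [set: 'I_n]%SET>>%VS = fullv.
  by rewrite dimvf dim_matrix mulr1.
apply/eqP; rewrite eqEsubv subvf; apply/subvP => x _; apply: contraT.
case/separating_functional => c [/sub_annihilated c0].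
by rewrite [c]functional_eq0 ?mul0mx ?mxE ?eqxx// => i; exact: c0.
Qed.

Lemma has_dim_polytope d : has_dim P d <-> r%:Z = d + 1.
Proof.
rewrite -[X in Posz X = _]dim_vertices; apply: (has_dim_span (h := h)).
- exact: conv_height.
- move=> _ [b [_ _ ->]]; apply: memv_suml => i _; apply/memvZ/memv_span/map_f.
  by rewrite mem_enum inE.
- by move=> x /mapP[i _ ->]; exact: conv_vertex.
Qed.

(** A point of the face is a convex combination of columns on which c is
    nonnegative; as c is 0 at the point, only the columns on which c is 0 have a
    nonzero coefficient. *)
Lemma has_dim_zero_face c d : (forall i, 0 <= (c *m M) 0 i) ->
  has_dim (zero_face c) d <->
  (\dim <<vertices [set i | (c *m M) 0 i == 0]%SET>>)%:Z = d + 1.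
Proof.
move=> c0; apply: (has_dim_span (h := h)).
- by move=> x [Px _]; exact: conv_height.
- move=> _ [[b [b0 _ ->]]]; rewrite mul_conv => /psumr_eq0P bc0.
  apply: memv_suml => i _; have [->|bi] := eqVneq (b i) 0.
    by rewrite scale0r mem0v.
  apply/memvZ/memv_span/map_f; rewrite mem_enum inE.
  have /eqP := bc0 (fun i _ => mulr_ge0 (b0 i) (c0 i)) i isT.
  by rewrite mulf_eq0 (negPf bi).
- by move=> x /mapP[i]; rewrite mem_enum inE -mem_zero_face in_setE => ? ->.
Qed.

Lemma facet_support W :
  (exists F, is_facet P F /\ ~: W = [set i | u i \in F]%SET) <->
  (exists c, positive_support c W /\ (\dim <<vertices (~: W)>>).+1 = r).
Proof.
have WC c : W = [set i | (c *m M) 0 i != 0]%SET ->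
    ~: W = [set i | (c *m M) 0 i == 0]%SET.
  by move->; apply/setP => i; rewrite !inE negbK.
split => [[_ [[/is_face_zero_face[c [c0 ->]] [d [dP dF]]] /setC_zero_face WE]]|].
  move: dP dF; rewrite has_dim_polytope has_dim_zero_face// -WC// subrK => rd dF.
  have {rd dF} dimW : (\dim <<vertices (~: W)>>).+1 = r.
    by have /eqP := rd; rewrite -dF -PoszD eqz_nat addn1 => /eqP.
  (* For c = 0 the face is P itself, whose columns span the whole space. *)
  exists c; split => //; split => //; apply: contra_eq_neq dimW => cn0.
  rewrite WE cn0 (_ : ~: _ = [set: 'I_n]%SET) ?dim_vertices ?gtn_eqF//.
  by apply/setP => i; rewrite !inE mul0mx mxE eqxx.
case=> c [[cn0 c0 WE] dF]; exists (zero_face c).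
split; last exact/setC_zero_face.
split; first exact: zero_face_is_face.
exists (\dim <<vertices (~: W)>>)%:Z.
rewrite has_dim_polytope has_dim_zero_face// -WC// subrK; split => //.
by rewrite -[X in X%:Z = _]dF -addn1 PoszD.
Qed.

(** A ratio test: up to sign, c' is positive on some column, and the vector
    c - q *: c' for the smallest ratio q of their values stays nonnegative and
    vanishes on one more column. *)
Lemma reduce_support c c' W :
  positive_support c W -> (forall i, i \notin W -> (c' *m M) 0 i = 0) ->
  ~ (exists t, c' = t *: c) ->
  exists c'' W', W' \proper W /\ positive_support c'' W'.
Proof.
wlog [i0 ci0] : c' / exists i, 0 < (c' *m M) 0 i.
  move=> wl suppc cW prop.
  have [i ci] : exists i, (c' *m M) 0 i != 0.
    apply: contrapT => none; apply: prop; exists 0; rewrite scale0r.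
    apply: functional_eq0 => i; apply/eqP; apply: contraT => ci.
    by case: none; exists i.
  have [ci0|ci0] := ltrP 0 ((c' *m M) 0 i).
    by apply: (wl c') => //; exists i.
  apply: (wl (- c')) => //.
  - by exists i; rewrite mulNmx mxE oppr_gt0 lt_neqAle ci.
  - by move=> j jW; rewrite mulNmx mxE cW ?oppr0.
  - by case=> t ct; apply: prop; exists (- t); rewrite scaleNr -ct opprK.
case=> cn0 c0 WE cW prop.
pose q i := (c *m M) 0 i / (c' *m M) 0 i.
have [i1 ci1 minq] :=
  @Order.TotalTheory.arg_minP _ _ _ i0 (fun i => 0 < (c' *m M) 0 i) q ci0.
pose c'' := c - q i1 *: c'.
have c''E i : (c'' *m M) 0 i = (c *m M) 0 i - q i1 * (c' *m M) 0 i.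
  by rewrite mulmxBl -scalemxAl; move: (c *m M) (c' *m M) => ? ?; rewrite !mxE.
have zero i : i \notin W -> (c'' *m M) 0 i = 0.
  move=> iW; rewrite c''E cW// mulr0 subr0.
  by move: iW; rewrite WE inE negbK => /eqP.
have zero1 : (c'' *m M) 0 i1 = 0 by rewrite c''E divfK ?subrr ?gt_eqF.
exists c'', [set i | (c'' *m M) 0 i != 0]%SET; split; last split => //.
- apply/properP; split.
    by apply/fintype.subsetP => i; rewrite inE; apply: contraR => /zero ->.
  exists i1; last by rewrite inE zero1 eqxx.
  by apply: contraT => /cW ci; rewrite ci ltxx in ci1.
- apply/eqP => /subr0_eq cE; apply: prop; exists (q i1)^-1.
  rewrite cE scalerA mulVf ?scale1r//; apply: contraNneq cn0 => q0.
  by rewrite cE q0 scale0r.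
- move=> i; rewrite c''E subr_ge0; have [ci|ci] := ltrP 0 ((c' *m M) 0 i).
    by rewrite -ler_pdivlMr//; exact: minq.
  apply: le_trans (c0 i); apply: mulr_ge0_le0 => //.
  by rewrite divr_ge0// ltW.
Qed.

(** All the functionals with support inside W vanish on the columns outside W.
    These columns span a hyperplane iff such functionals are unique up to a
    factor, and if they are not then [reduce_support] shrinks W. *)
Lemma minimal_support_facet W :
  (exists F, is_facet P F /\ ~: W = [set i | u i \in F]%SET) <->
  (exists c, positive_support c W) /\
  (forall W', W' \proper W -> ~ exists c, positive_support c W').
Proof.
have vanish c V : positive_support c V -> V \subset W ->
    (<<vertices (~: W)>> <= annihilated c)%VS.
  move=> [_ _ VE] /fintype.subsetP VW; apply/sub_annihilated => i; rewrite inE => iW.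
  by apply/eqP; apply: contraNT iW => ci; apply: VW; rewrite VE inE.
rewrite facet_support; split => [[c [suppc dF]]|[[c suppc] minW]].
  split => [|W' W'W [c' suppc']]; first by exists c.
  have cn0 : c != 0 by case: suppc.
  have [t c'E] := (dim_hyperplaneP cn0 (vanish _ _ suppc (subxx _))).1 dF c'
    (vanish _ _ suppc' (proper_sub W'W)).
  case: suppc suppc' W'W => _ _ -> [c'n0 _ ->].
  have t0 : t != 0 by apply: contraNneq c'n0 => t0; rewrite c'E t0 scale0r.
  suff -> : [set i | (c' *m M) 0 i != 0]%SET = [set i | (c *m M) 0 i != 0]%SET.
    by rewrite fintype.properxx.
  by apply/setP => i; rewrite !inE c'E -scalemxAl mxE mulf_eq0 (negPf t0).
exists c; split => //; have cn0 : c != 0 by case: suppc.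
apply/(dim_hyperplaneP cn0 (vanish _ _ suppc (subxx _))) => c' /sub_annihilated c'0.
apply: contrapT => prop.
have [|c'' [W' [W'W supp]]] := reduce_support suppc _ prop.
  by move=> i iW; apply: c'0; rewrite inE.
by apply: (minW W' W'W); exists c''.
Qed.

End Polytope.

(** * Orthogonal families of rows *)

Lemma dotE (R : comPzRingType) n (x y : 'rV[R]_n) :
  \sum_v x 0 v * y 0 v = (y *m x^T) 0 0.
Proof. by rewrite mxE; apply: eq_bigr => v _; rewrite mulrC [in RHS]mxE. Qed.

Section OrthogonalRows.
Variables (R : realFieldType) (p n : nat) (M : 'M[R]_(p, n)).
Hypotheses (M_neq0 : forall i, row i M != 0).
Hypotheses (M_orth : forall i j, i != j -> row i M *m (row j M)^T = 0).

Lemma row_norm_neq0 i : (row i M *m (row i M)^T) 0 0 != 0.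
Proof.
apply: contra (M_neq0 i) => /eqP; rewrite mxE => dot0.
have /psumr_eq0P sq0 : \sum_j row i M 0 j ^+ 2 = 0.
  by rewrite -[RHS]dot0; apply: eq_bigr => j _; rewrite expr2 [X in _ = _ * X]mxE.
apply/eqP/rowP => j; rewrite [RHS]mxE; apply/eqP; rewrite -sqrf_eq0.
by apply/eqP/sq0 => // l _; exact: sqr_ge0.
Qed.

(** The coordinates of a vector on orthogonal rows are read off from its scalar
    products with these rows. *)
Lemma mul_orth_row (x : 'rV[R]_p) i :
  (x *m M *m (row i M)^T) 0 0 = x 0 i * (row i M *m (row i M)^T) 0 0.
Proof.
rewrite (mulmx_sum_row x) mulmx_suml summxE (bigD1 i)//= -scalemxAl [LHS]addrC mxE.
rewrite big1 ?add0r// => j ji.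
by rewrite -scalemxAl M_orth// scaler0 mxE.
Qed.

Lemma orth_row_free : row_free M.
Proof.
apply: inj_row_free => x xM0; apply/rowP => i; rewrite [RHS]mxE.
have := mul_orth_row x i; rewrite xM0 mul0mx mxE => /esym/eqP.
by rewrite mulf_eq0 (negPf (row_norm_neq0 i)) orbF => /eqP.
Qed.

End OrthogonalRows.

(** * Designs as supports of vectors of the row space *)

Section Designs.
Variables (R : realType) (n : nat) (e : rel 'I_n) (m : nat) (lam : m.-tuple R).
Variables (U : 'M[R]_n) (k : nat).
Hypotheses (lam_ordering : eigen_ordering e lam).
Hypotheses (Lambda1 : (Lambda e lam 1 :=: (const_mx 1 : 'rV[R]_n))%MS).
Hypotheses (U_eigen : eigenvector_matrix e lam U).
Hypotheses (k_bounds : (1 <= k < m)%N).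
Implicit Types (a phi : 'rV[R]_n) (W : {set 'I_n}) (i : 'I_n) (j : nat).

Local Notation K := (kbar_rows e lam U k).
Local Notation M := (Ukbar e lam U k).
Local Notation rU i := (row i U).

Let U_neq0 i : rU i != 0. Proof. by case: U_eigen => /(_ i)[]. Qed.

Let U_orth i i' : i != i' -> rU i *m (rU i')^T = 0.
Proof. by case: U_eigen => _ /(_ i i'). Qed.

(** There is no eigenvector in dimension 0, but there are m > 0 eigenvalues. *)
Lemma n_gt0 : (0 < n)%N.
Proof.
have m0 : (0 < m)%N by case/andP: k_bounds => _; apply: leq_trans.
have : lam`_0 \in lam by rewrite mem_nth ?size_tuple.
case: lam_ordering => _ ->; case/eigenvalueP => v _.
by case: (n) v => // v; rewrite thinmx0 eqxx.
Qed.

Let i0 : 'I_n := Ordinal n_gt0.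

Lemma row_i0 : rU i0 = const_mx 1.
Proof. by case: U_eigen => _ _ _; apply. Qed.

Lemma i0_kbar : i0 \in K.
Proof. by rewrite inE row_i0 Lambda1 submx_refl. Qed.

Lemma Lambda_inj i j j' : (1 <= j <= m)%N -> (1 <= j' <= m)%N ->
  (rU i <= Lambda e lam j)%MS -> (rU i <= Lambda e lam j')%MS -> j = j'.
Proof.
move=> /andP[j0 jm] /andP[j'0 j'm] /eigenspaceP Uj /eigenspaceP.
rewrite Uj => /eqP; rewrite -subr_eq0 -scalerBl scaler_eq0 (negPf (U_neq0 i)).
rewrite orbF subr_eq0 nth_uniq ?size_tuple ?prednK//; last by case: lam_ordering.
by case: j j0 {jm Uj} => // j _; case: j' j'0 {j'm} => // j' _ /eqP /= ->.
Qed.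

(** Apart from the first one, no row of U lies in Lambda_1: it would be
    proportional to the all-ones row and orthogonal to it.  So the rows left out
    of Ukbar are those of Lambda_2, ..., Lambda_k. *)
Lemma mem_kbar_rows i j : i != i0 -> (1 <= j <= m)%N ->
  (rU i <= Lambda e lam j)%MS -> (i \in K) = (k < j)%N.
Proof.
move=> ii0 jm Uj; case/andP: (k_bounds) => k1 km.
have not1 : ~~ (rU i <= Lambda e lam 1)%MS.
  apply: contra (U_neq0 i); rewrite Lambda1 -row_i0 => /sub_rVP[t Ut].
  have /matrixP/(_ 0 0) := U_orth ii0; rewrite Ut -scalemxAl mxE [RHS]mxE.
  move/eqP; rewrite mulf_eq0 (negPf (row_norm_neq0 U_neq0 i0)) orbF => /eqP->.
  by rewrite scale0r.
rewrite inE (negPf not1) /=; apply/hasP/idP => [[j']|kj].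
  rewrite mem_iota addSn subnKC ?(ltnW km)// ltnS => /andP[kj' j'm] Uj'.
  rewrite (Lambda_inj jm _ Uj Uj')//.
  by rewrite (leq_trans _ j'm)// (leq_trans _ kj').
exists j => //; rewrite mem_iota kj addSn subnKC ?(ltnW km)//.
by case/andP: jm.
Qed.

(** Comparing the coordinates on the eigenbasis U in phi *m A = a *: phi shows
    that phi has no component on the rows with another eigenvalue. *)
Lemma Lambda_orth_row phi j i : (phi <= Lambda e lam j)%MS ->
  ~~ (rU i <= Lambda e lam j)%MS -> phi *m (rU i)^T = 0.
Proof.
move=> /eigenspaceP phij Ui.
have Ufree := orth_row_free U_neq0 U_orth.
have /submxP[x phiE] : (phi <= U)%MS.
  by rewrite submx_full// row_full_unit -row_free_unit.
have [d dE] : exists d : 'rV[R]_n, U *m (walk_mx R e)^T = diag_mx d *m U.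
  have ex l : exists a : R, rU l *m (walk_mx R e)^T = a *: rU l.
    by case: U_eigen => /(_ l)[_ [j' _ /eigenspaceP]]; exists lam`_j'.-1.
  have [f fE] := choice ex.
  exists (\row_l f l); apply/row_matrixP => l.
  by rewrite row_mul fE row_mul row_diag_mx -scalemxAl -rowE mxE.
have : x *m diag_mx d = lam`_j.-1 *: x.
  apply: (row_free_inj Ufree); rewrite -mulmxA -dE mulmxA -phiE phij phiE.
  by rewrite scalemxAl.
move/rowP/(_ i)/eqP; rewrite mul_mx_diag !mxE mulrC -subr_eq0 -mulrBl.
rewrite mulf_eq0 subr_eq0 => /orP[/eqP di|/eqP xi]; last first.
  by apply/matrixP => a b; rewrite !ord1 phiE (mul_orth_row U_orth) xi mul0r mxE.
case/negP: Ui; apply/eigenspaceP; rewrite -row_mul dE -di.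
by rewrite row_mul row_diag_mx -scalemxAl -rowE.
Qed.

Lemma Ukbar_row_free : row_free M.
Proof.
apply: orth_row_free => [l|l l' ll']; rewrite !row_rowsub//.
by apply: U_orth; apply: contra_neq ll' => /enum_val_inj.
Qed.

(** The row space of Ukbar is the orthogonal complement of the rows of U left
    out, because all the rows of U form an orthogonal basis. *)
Lemma sub_UkbarP a : reflect (forall i, i \notin K -> a *m (rU i)^T = 0) (a <= M)%MS.
Proof.
apply: (iffP idP) => [/submxP[x ->] i iK|aK].
  rewrite (mulmx_sum_row x) mulmx_suml big1// => l _.
  rewrite row_rowsub -scalemxAl U_orth ?scaler0//.
  by apply: contraNneq iK => <-; exact: enum_valP.
have Ufree := orth_row_free U_neq0 U_orth.
have /submxP[x aE] : (a <= U)%MS.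
  by rewrite submx_full// row_full_unit -row_free_unit.
rewrite aE mulmx_sum_row summx_sub// => i _.
have [iK|/aK ai] := boolP (i \in K).
  have <- : row (enum_rank_in iK i) M = rU i by rewrite row_rowsub enum_rankK_in.
  exact/scalemx_sub/row_sub.
have := mul_orth_row U_orth x i; rewrite -aE ai mxE => /esym/eqP.
rewrite mulf_eq0 (negPf (row_norm_neq0 U_neq0 i)) orbF => /eqP->.
by rewrite scale0r sub0mx.
Qed.

Lemma ones_Ukbar : ((const_mx 1 : 'rV[R]_n) <= M)%MS.
Proof.
apply/sub_UkbarP => i iK; rewrite -row_i0 U_orth//.
by apply: contraNneq iK => <-; exact: i0_kbar.
Qed.

(** Applied to the weights and to the all-ones vector, this shows that both sides
    of the design condition are 0 on Lambda_2, ..., Lambda_k. *)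
Lemma dot_Ukbar_Lambda a phi j : (a <= M)%MS -> (1 < j <= k)%N ->
  (phi <= Lambda e lam j)%MS -> \sum_v a 0 v * phi 0 v = 0.
Proof.
move=> /submxP[x ->] /andP[j1 jk] phij; case/andP: k_bounds => k1 km.
have jm : (1 <= j <= m)%N by rewrite ltnW//= (leq_trans jk (ltnW km)).
suff dot0 : phi *m (x *m M)^T = 0.
  by rewrite dotE dot0 mxE.
rewrite trmx_mul mulmxA (_ : phi *m M^T = 0) ?mul0mx//.
apply: trmx_inj; rewrite trmx_mul trmxK trmx0; apply/row_matrixP => l.
rewrite row_mul row_rowsub row0; apply: trmx_inj.
rewrite trmx_mul trmxK trmx0; apply: (Lambda_orth_row phij).
apply/negP => Uj; have := enum_valP l; set i := enum_val l in Uj * => iK.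
have [ii0|ii0] := eqVneq i i0.
  have U1 : (rU i <= Lambda e lam 1)%MS by rewrite ii0 row_i0 Lambda1.
  have j1E := Lambda_inj jm _ Uj U1.
  by move: j1; rewrite j1E// (leq_ltn_trans _ km).
by move: iK; rewrite (mem_kbar_rows ii0 jm Uj) ltnNge jk.
Qed.

Lemma sum_ones phi :
  \sum_v phi 0 v = \sum_v (const_mx 1 : 'rV[R]_n) 0 v * phi 0 v.
Proof. by apply: eq_bigr => v _; rewrite mxE mul1r. Qed.

(** The weights of a design, extended by 0 outside W, form the vector c *m M;
    conversely this vector is scaled to have sum 1, which is what the design
    condition demands for the constant functions. *)
Lemma positive_design_support W :
  positive_design e lam k W <-> exists c, positive_support M c W.
Proof.
case/andP: (k_bounds) => k1 km.
have nn0 : n%:R != 0 :> R by rewrite pnatr_eq0 -lt0n n_gt0.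
split => [[a [a_gt0 aE]]|[c [cn0 c0 WE]]].
  pose b : 'rV[R]_n := \row_i (if i \in W then a i else 0).
  have bE phi : \sum_v b 0 v * phi 0 v = \sum_(w in W) a w * phi 0 w.
    rewrite [RHS]big_mkcond; apply: eq_bigr => v _; rewrite mxE.
    by case: ifP; rewrite ?mul0r.
  have : (b <= M)%MS.
    apply/sub_UkbarP => i iK; apply/matrixP => p q; rewrite !ord1 [RHS]mxE.
    case: U_eigen => /(_ i)[_ [j jm Uj]] _ _ _.
    have ii0 : i != i0 by apply: contraNneq iK => ->; exact: i0_kbar.
    have jk : (1 <= j <= k)%N.
      move: iK; rewrite (mem_kbar_rows ii0 jm Uj) -leqNgt => ->.
      by case/andP: jm => ->.
    rewrite -dotE; under eq_bigr do rewrite mulrC.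
    by rewrite bE (aE j)// sum_ones dotE -row_i0 U_orth// mxE mulr0.
  case/submxP => c bc; exists c; rewrite /positive_support -bc; split.
  (* The weights are not all 0: by the condition for Lambda_1 their sum is 1. *)
  - apply: contra_eq_neq (aE 1%N (const_mx 1) _ _) => [c0||]; last by rewrite Lambda1.
      rewrite -bE bc c0 mul0mx big1 => [|v _]; last by rewrite mxE mul0r.
      rewrite (eq_bigr (fun=> 1)) => [|v _]; last by rewrite mxE.
      by rewrite sumr_const card_ord mulVf// eq_sym oner_eq0.
    by rewrite k1.
  - by move=> i; rewrite mxE; case: ifP => // /a_gt0/ltW.
  - apply/setP => i; rewrite !inE mxE; case: ifP => [/a_gt0/gt_eqF->//|].
    by rewrite eqxx.
pose b := c *m M; pose s := \sum_v b 0 v.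
have bW phi :
    \sum_(w in W) b 0 w / s * phi 0 w = s^-1 * \sum_v b 0 v * phi 0 v.
  rewrite big_mkcond mulr_sumr; apply: eq_bigr => v _; rewrite WE inE /b.
  case: eqVneq => [->|_] /=; first by rewrite mul0r mulr0.
  by rewrite [RHS]mulrA [s^-1 * _]mulrC.
have s0 : s != 0.
  apply: contra cn0 => /eqP/psumr_eq0P s0; apply/eqP.
  apply: (functional_eq0 Ukbar_row_free) => i.
  by apply: s0 => // l _; exact: c0.
exists (fun w => b 0 w / s); split => [w|j phi jk].
  rewrite WE inE => bw; rewrite divr_gt0// lt_neqAle eq_sym ?bw ?c0 ?s0//=.
  by apply: sumr_ge0 => i _; apply: c0.
have [j1 phij|j1 phij] := eqVneq j 1%N.
  move: phij; rewrite j1 Lambda1 => /sub_rVP[t ->].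
  rewrite bW (eq_bigr (fun v => b 0 v * t)) => [|v _]; last by rewrite !mxE mulr1.
  rewrite -mulr_suml mulrA mulVf// mul1r.
  rewrite (eq_bigr (fun=> t)) => [|v _]; last by rewrite !mxE mulr1.
  by rewrite sumr_const card_ord -[t *+ n]mulr_natl mulrA mulVf// mul1r.
have j1k : (1 < j <= k)%N by rewrite ltn_neqAle eq_sym j1.
rewrite bW sum_ones !(dot_Ukbar_Lambda _ j1k phij) ?mulr0 ?ones_Ukbar//.
exact: submxMl.
Qed.

End Designs.

Theorem theorem3p8 (R : realType) (n : nat) (e : rel 'I_n) (delta : nat)
    (m : nat) (lam : m.-tuple R) (U : 'M[R]_n) (W : {set 'I_n}) (k : nat)
    (e_simple : simple_graph e)
    (e_connected : connected_graph e)
    (e_regular : regular_graph e delta)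
    (lam_ordering : eigen_ordering e lam)
    (Lambda1 : (Lambda e lam 1 :=: (const_mx 1 : 'rV[R]_n))%MS)
    (U_eigen : eigenvector_matrix e lam U)
    (k_bounds : (1 <= k < m)%N) :
  let ustar := fun i : 'I_n => col i (Ukbar e lam U k) in
  let P := conv ustar in
  (positive_design e lam k W <->
     exists F, [/\ is_face P F, F <> P & ~: W = [set i | ustar i \in F]%SET]) /\
  (minimal_positive_design e lam k W <->
     exists F, is_facet P F /\ ~: W = [set i | ustar i \in F]%SET).
Proof.
have designE V : positive_design e lam k V <->
    exists c, positive_support (Ukbar e lam U k) c V.
  exact: positive_design_support.
have M_free : row_free (Ukbar e lam U k) by exact: Ukbar_row_free U_eigen.
have /submxP[h /esym hM] : ((const_mx 1 : 'rV[R]_n) <= Ukbar e lam U k)%MS.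
  exact: ones_Ukbar.
move=> ustar P; split; first by rewrite designE (proper_face_support M_free hM).
rewrite (minimal_support_facet M_free hM) /minimal_positive_design designE.
by split=> -[supp minW]; split => // W' W'W; move/designE; exact: minW.
Qed.
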